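(* Let $\varepsilon>0$, let $k\ge 1$ be an integer and let $\varepsilon_g\in\mathbb{R}$. Let $\mathcal{M}_{\mathrm{BR}}^k$ be the class of nonadaptive compositions $M_1\times\cdots\times M_k$ of $\varepsilon$-bounded-range mechanisms. For $\ell\in\{0,1,\dots,k\}$ let $t_\ell^*=\frac{\varepsilon_g+(\ell+1)\varepsilon}{k+1}$, where if this number is not in $[0,\varepsilon]$ then $t_\ell^*$ is instead taken to be the closest point of $[0,\varepsilon]$. For $t\in[0,\varepsilon]$ let $p_t=\frac{e^{-t}-e^{-\varepsilon}}{1-e^{-\varepsilon}}$. Then $$\delta_{\mathrm{opt}}(\mathcal{M}_{\mathrm{BR}}^k,\varepsilon_g)=\max_{0\le \ell\le k}\ \sum_{i=0}^k\binom{k}{i}\,p_{t_\ell^*}^{\,k-i}\,(1-p_{t_\ell^*})^{i}\,\max\left\{e^{k t_\ell^*-i\varepsilon}-e^{\varepsilon_g},\,0\right\}.$$ Furthermore, this quantity can be computed in $O(k^2)$ time.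
   Context: A data universe is a set $\mathcal{X}$ with a symmetric neighboring relation $x\sim x'$. A mechanism $M:\mathcal{X}\to\mathcal{Y}$ assigns to each $x$ a probability distribution of a random outcome $M(x)\in\mathcal{Y}$; $\Pr[M(x)=y]$ denotes the probability mass function, or, for continuous outcome spaces, the probability density function with respect to a common reference measure. $M$ is $\varepsilon$-bounded-range ($\varepsilon$-BR) if for all neighbors $x\sim x'$ and all $y_1,y_2\in\mathcal{Y}$, $\frac{\Pr[M(x)=y_1]}{\Pr[M(x')=y_1]}\le e^{\varepsilon}\frac{\Pr[M(x)=y_2]}{\Pr[M(x')=y_2]}$ (understood in cross-multiplied form when probabilities vanish). $M$ is $(\varepsilon,\delta)$-DP if $\Pr[M(x)\in S]\le e^{\varepsilon}\Pr[M(x')\in S]+\delta$ for all $x\sim x'$ and all (measurable) $S\subseteq\mathcal{Y}$. For $\varepsilon_g\in\mathbb{R}$, $\delta_{\mathrm{opt}}(M,\varepsilon_g)=\inf\{\delta: M\text{ is }(\varepsilon_g,\delta)\text{-DP}\}$, and for a class $\mathcal{M}$ of mechanisms $\delta_{\mathrm{opt}}(\mathcal{M},\varepsilon_g)=\sup_{M\in\mathcal{M}}\delta_{\mathrm{opt}}(M,\varepsilon_g)$. $\mathcal{M}_{\mathrm{BR}}^k=\{M_1\times\cdots\times M_k: \text{each } M_i\text{ is }\varepsilon\text{-BR}\}$, where $M_1\times\cdots\times M_k$ maps $x$ to $(M_1(x),\dots,M_k(x))$ with the $k$ outcomes drawn independently; data universe (having at least one neighboring pair) and outcome spaces are arbitrary.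 Convention $0^0=1$. Time counts elementary real operations (arithmetic, comparison, evaluation of $\exp$) at unit cost. *)

(* Defs.v *)
(* MathComp-Analysis: the reals are an arbitrary R : realType. *)
From HB Require Import structures.
From mathcomp Require Import all_boot all_order all_algebra.
From mathcomp Require Import all_classical all_reals all_analysis.

Set Implicit Arguments.
Unset Strict Implicit.
Unset Printing Implicit Defensive.

Import Order.TTheory GRing.Theory Num.Theory.
Import numFieldNormedType.Exports.

Local Open Scope classical_set_scope.
Local Open Scope ring_scope.

(* A discrete outcome space is one whose measurable sets are all its subsets. *)
Record mechanism (R : realType) (X : Type) : Type := Mechanism {
  outcome_display : measure_display ;
  outcome : measurableType outcome_display ;
  law : X -> probability outcome R }.

(* f x is the density of M x with respect to a reference measure mu common to
   all x; mass functions are the case of the counting measure, which is why mu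
   is not required to be sigma-finite. *)
Definition is_density (R : realType) (X : Type) (M : mechanism R X)
    (mu : {measure set (outcome M) -> \bar R}) (f : X -> outcome M -> R) : Prop :=
  forall x,
    [/\ measurable_fun setT (f x),
        forall y, 0 <= f x y &
        forall A, measurable A ->
          law M x A = (\int[mu]_(y in A) (f x y)%:E)%E].

(* Densities are determined only almost everywhere, so the bound is required of
   some version of them. *)
Definition bounded_range (R : realType) (X : Type) (nb : X -> X -> Prop)
    (eps : R) (M : mechanism R X) : Prop :=
  exists (mu : {measure set (outcome M) -> \bar R}) (f : X -> outcome M -> R),
    is_density mu f /\
    forall x x', nb x x' -> forall y1 y2,
      f x y1 * f x' y2 <= expR eps * (f x y2 * f x' y1).

Definition dp (R : realType) (X : Type) (nb : X -> X -> Prop)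
    (eps delta : R) (M : mechanism R X) : Prop :=
  forall x x', nb x x' -> forall S : set (outcome M), measurable S ->
    (law M x S <= (expR eps)%:E * law M x' S + delta%:E)%E.

Definition delta_opt (R : realType) (X : Type) (nb : X -> X -> Prop)
    (M : mechanism R X) (epsg : R) : \bar R :=
  ereal_inf [set delta%:E | delta in [set delta | dp nb epsg delta M]].

(* A class is a plain predicate because mechanism R X is too large a type for
   the library's set. *)
Definition delta_opt_class (R : realType) (X : Type) (nb : X -> X -> Prop)
    (C : mechanism R X -> Prop) (epsg : R) : \bar R :=
  ereal_sup [set d | exists2 M, C M & d = delta_opt nb M epsg].

Definition mech_prod (R : realType) (X : Type) (M N : mechanism R X) :
    mechanism R X :=
  @Mechanism R X _ (outcome M * outcome N)%type
    (fun x => (law M x \x law N x)%E : probability _ R).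

(* composition M n = M 0 x ... x M n has n.+1 factors, associated to the left. *)
Fixpoint composition (R : realType) (X : Type) (M : nat -> mechanism R X)
    (n : nat) : mechanism R X :=
  if n is n'.+1 then mech_prod (composition M n') (M n) else M 0%N.

(* Meaningful for 0 < k only. *)
Definition BR_compositions (R : realType) (X : Type) (nb : X -> X -> Prop)
    (eps : R) (k : nat) (N : mechanism R X) : Prop :=
  exists2 M : nat -> mechanism R X,
    (forall i, (i < k)%N -> bounded_range nb eps (M i)) &
    N = composition M k.-1.

Definition p_ (R : realType) (eps t : R) : R :=
  (expR (- t) - expR (- eps)) / (1 - expR (- eps)).

Definition t_star (R : realType) (eps epsg : R) (k l : nat) : R :=
  let t := (epsg + l.+1%:R * eps) / k.+1%:R in
  if t < 0 then 0 else if eps < t then eps else t.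

Definition delta_term (R : realType) (eps epsg : R) (k l : nat) : R :=
  let t := t_star eps epsg k l in
  \sum_(i < k.+1) 'C(k, i)%:R * p_ eps t ^+ (k - i) * (1 - p_ eps t) ^+ i
    * Num.max (expR (k%:R * t - i%:R * eps) - expR epsg) 0.

(* The default value of the maximum is its own term l = 0. *)
Definition delta_formula (R : realType) (eps epsg : R) (k : nat) : R :=
  \big[Num.max/delta_term eps epsg k 0]_(l < k.+1) delta_term eps epsg k l.

(* A real-number machine with unit-cost arithmetic, comparison and exp. Each
   program uses finitely many registers, all real-valued, and no indirect
   addressing; the constants available to it are the natural numbers. The tests
   of If i j and While i j are r_i <= r_j. *)
Inductive arith : Type := Add | Sub | Mul | Div.

Inductive program : Type :=
| Skip
| Const (i n : nat)
| Arith (op : arith) (i j l : nat)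
| Exp (i j : nat)
| Seq (P Q : program)
| If (i j : nat) (P Q : program)
| While (i j : nat) (P : program).

Definition state (R : realType) : Type := nat -> R.

Definition upd (R : realType) (s : state R) (i : nat) (v : R) : state R :=
  fun j => if j == i then v else s j.

Definition arith_fun (R : realType) (op : arith) : R -> R -> R :=
  match op with
  | Add => fun a b => a + b
  | Sub => fun a b => a - b
  | Mul => fun a b => a * b
  | Div => fun a b => a / b
  end.

(* run P s n s': started in s, P halts in s' after n elementary operations.
   Division by zero blocks. *)
Inductive run (R : realType) : program -> state R -> nat -> state R -> Prop :=
| run_skip s : run Skip s 0 s
| run_const s i n : run (Const i n) s 1 (upd s i n%:R)
| run_arith s op i j l : (op = Div -> s l != 0) ->
    run (Arith op i j l) s 1 (upd s i (arith_fun op (s j) (s l)))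
| run_exp s i j : run (Exp i j) s 1 (upd s i (expR (s j)))
| run_seq P Q s s' s'' m n :
    run P s m s' -> run Q s' n s'' -> run (Seq P Q) s (m + n)%N s''
| run_if_true i j P Q s s' n : s i <= s j ->
    run P s n s' -> run (If i j P Q) s n.+1 s'
| run_if_false i j P Q s s' n : s j < s i ->
    run Q s n s' -> run (If i j P Q) s n.+1 s'
| run_while_true i j P s s' s'' m n : s i <= s j ->
    run P s m s' -> run (While i j P) s' n s'' ->
    run (While i j P) s (m + n).+1 s''
| run_while_false i j P s : s j < s i -> run (While i j P) s 1 s.

Definition input (R : realType) (eps epsg : R) (k : nat) : state R :=
  nth 0 [:: eps; epsg; k%:R].

(* Main.v *)
Require Import Defs.
From HB Require Import structures.
From mathcomp Require Import all_boot all_order all_algebra.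
From mathcomp Require Import all_classical all_reals all_analysis.
From mathcomp Require Import simple_functions measurable_realfun.
From mathcomp Require Import measurable_fun_approximation.
From mathcomp Require Import ring lra zify.

(* For a pair of neighbors, the eps-BR condition says that the likelihood ratio
   of M takes values in some [e^(t - eps), e^t] with 0 <= t <= eps. Since the
   ratio has mean 1, every convex function of it has at most the expectation it
   has under the two-point law on the endpoints: M is dominated by randomized
   response with offset t, whose upper outcome has mass p_t. Doing this for one
   factor at a time bounds delta by the value for a product of k randomized
   responses with offsets t_1, ..., t_k. Moving two offsets towards each other
   with constant sum spreads the ratio of the pair while preserving its mean,
   so the worst case has all t_i equal. For a common offset t, the sum truncated
   at i <= l has a derivative in t with the sign of
   e^epsg - e^((k + 1) t - (l + 1) eps), hence is largest at t_l^*; and the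
   positive part selects one of the truncations. *)

Set Implicit Arguments.
Unset Strict Implicit.
Unset Printing Implicit Defensive.

Import Order.TTheory GRing.Theory Num.Theory.
Import numFieldNormedType.Exports.

Local Open Scope ring_scope.

(** * Products of randomized responses *)

Section RandomizedResponse.
Variables (R : realType) (eps : R).

Local Notation p := (p_ eps).
Local Notation inI t := (0 <= t <= eps).

Lemma expRN_lt1 : 0 < eps -> expR (- eps) < 1.
Proof. by move=> eps_gt0; rewrite -expR0 ltr_expR; lra. Qed.

Lemma p_itv t : 0 < eps -> inI t -> 0 <= p t <= 1.
Proof.
move=> eps_gt0 /andP[t0 te]; have a1 := expRN_lt1 eps_gt0; rewrite /p_.
have h : 0 < 1 - expR (- eps) by lra.
rewrite divr_ge0 ?(ltW h) //=; last by rewrite subr_ge0 ler_expR; lra.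
by rewrite ler_pdivrMr // mul1r lerD2r -[leRHS]expR0 ler_expR; lra.
Qed.

(** This is what fixes [p t]: the likelihood ratio must have mean 1, so that tilting the two-point
    law by it gives a probability law again. *)
Lemma p_mean t : 0 < eps -> p t * expR t + (1 - p t) * expR (t - eps) = 1.
Proof.
move=> eps_gt0; have a1 := expRN_lt1 eps_gt0; rewrite /p_ expRD (expRN t).
have t0 := expR_gt0 t; set a := expR (- eps) in a1 *.
by field; rewrite gt_eqF //=; lra.
Qed.

(* The largest value of w P(S) - c Q(S) over events S, where Q is the product of
   the laws (p_t, 1 - p_t) for t in ts and P has likelihood ratio e^t,
   respectively e^(t - eps), on the two outcomes of each factor. *)
Fixpoint rr_div (c : R) (ts : seq R) (w : R) : R :=
  if ts is t :: ts' then
    p t * rr_div c ts' (w * expR t) +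
      (1 - p t) * rr_div c ts' (w * expR (t - eps))
  else Num.max (w - c) 0.

(** As a function of the weight [w], [rr_div] is a nonnegative combination of the convex functions
    [Num.max (w * r - c) 0], one for each product [r] of likelihood ratios. *)
Lemma rr_div_convex c ts x y l : 0 < eps ->
  all (fun t => inI t) ts -> 0 <= l <= 1 ->
  rr_div c ts (l * x + (1 - l) * y) <=
    l * rr_div c ts x + (1 - l) * rr_div c ts y.
Proof.
move=> eps_gt0 + l01; elim: ts x y => [|t ts IH] x y /=.
  move=> _; move: l01 => /andP[l0 l1].
  rewrite ge_max; apply/andP; split.
    have hx : x - c <= Num.max (x - c) 0 by rewrite le_max lexx.
    have hy : y - c <= Num.max (y - c) 0 by rewrite le_max lexx.
    have := ler_wpM2l l0 hx.
    have l1' : 0 <= 1 - l by lra.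
    by have := ler_wpM2l l1' hy; lra.
  by rewrite addr_ge0 // mulr_ge0 ?le_max ?lexx ?orbT // subr_ge0.
move=> /andP[/(p_itv eps_gt0) /andP[p0 p1] tsI].
have h1 := IH (x * expR t) (y * expR t) tsI.
have h2 := IH (x * expR (t - eps)) (y * expR (t - eps)) tsI.
have p1' : 0 <= 1 - p t by lra.
have := ler_wpM2l p0 h1; have := ler_wpM2l p1' h2.
rewrite !(mulrDl (l * _)) -!(mulrA l) -!(mulrA (1 - l)).
lra.
Qed.

Lemma rr_div_swap c t1 t2 ts w :
  rr_div c (t1 :: t2 :: ts) w = rr_div c (t2 :: t1 :: ts) w.
Proof.
rewrite /= (mulrAC w (expR t2)) (mulrAC w (expR t2)).
rewrite !(mulrAC w (expR (t2 - eps))); ring.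
Qed.

Lemma rr_div_rem c t ts w : t \in ts ->
  rr_div c ts w = rr_div c (t :: rem t ts) w.
Proof.
elim: ts w => // s ts IH w; rewrite in_cons /=.
have [-> //|st /=] := eqVneq t s.
move=> tts; rewrite -[RHS]/(rr_div c (t :: s :: rem t ts) w) rr_div_swap.
by rewrite -[RHS]/(_ * rr_div c (t :: rem t ts) _ +
  _ * rr_div c (t :: rem t ts) _) -!IH.
Qed.

(** The product of the two likelihood ratios is [E], [E * a] or [E * (a * a)], where
    [E = expR (t1 + t2)] and [a = expR (- eps)], and depends on the offsets through their sum only.
    Just the masses of these three values change, which convexity at the middle value controls. *)
Lemma rr_div_exchange c (t1 t2 m : R) ts w : 0 < eps ->
  t1 <= m <= t2 -> all (fun t => inI t) ts ->
  rr_div c (t1 :: t2 :: ts) w <= rr_div c (m :: (t1 + t2 - m) :: ts) w.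
Proof.
move=> eps_gt0 /andP[t1m mt2] tsI /=.
set s := t1 + t2 - m.
have a1 := expRN_lt1 eps_gt0; pose a := expR (- eps).
have {}a1 : a < 1 by [].
have a0 : 0 < a := expR_gt0 _.
pose E := expR (t1 + t2).
have e1 x y : x + y = t1 + t2 -> w * expR x * expR y = w * E.
  by move=> xy; rewrite -mulrA -expRD xy.
have e2 x y : x + y = t1 + t2 -> w * expR x * expR (y - eps) = w * E * a.
  by move=> xy; rewrite -!mulrA -!expRD; congr (_ * expR _); lra.
have e3 x y : x + y = t1 + t2 -> w * expR (x - eps) * expR y = w * E * a.
  by move=> xy; rewrite -!mulrA -!expRD; congr (_ * expR _); lra.
have e4 x y : x + y = t1 + t2 ->
    w * expR (x - eps) * expR (y - eps) = w * E * (a * a).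
  by move=> xy; rewrite -!mulrA -!expRD; congr (_ * expR _); lra.
have ms : m + s = t1 + t2 by rewrite /s; lra.
rewrite (e1 _ _ erefl) (e2 _ _ erefl) (e3 _ _ erefl) (e4 _ _ erefl).
rewrite (e1 _ _ ms) (e2 _ _ ms) (e3 _ _ ms) (e4 _ _ ms).
(* The weight that writes the middle value as a mean of the outer two:
   [a / (1 + a) + a * a / (1 + a) = a]. *)
have l01 : 0 <= a / (1 + a) <= 1.
  by rewrite divr_ge0 ?ler_pdivrMr ?mul1r; lra.
have := rr_div_convex c (w * E) (w * E * (a * a)) eps_gt0 tsI l01.
have -> : a / (1 + a) * (w * E) + (1 - a / (1 + a)) * (w * E * (a * a)) =
  w * E * a.
  by field; lra.
set g0 := rr_div c ts (w * E); set g1 := rr_div c ts (w * E * a).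
set g2 := rr_div c ts (w * E * (a * a)) => cvx'.
have cvx : (1 + a) * g1 <= a * g0 + g2.
  have := ler_wpM2l (_ : 0 <= 1 + a) cvx'; move=> /(_ ltac:(lra)).
  by move/le_trans; apply; rewrite le_eqVlt; apply/predU1P; left; field; lra.
pose u (t : R) := expR (- t).
have uv x y : x + y = t1 + t2 -> u x * u y = expR (- (t1 + t2)).
  by move=> <-; rewrite /u -expRD; congr expR; lra.
have pE t : p t = (u t - a) / (1 - a) by [].
have um0 : 0 < u m := expR_gt0 _.
have ueq : u m * u s = u t1 * u t2 by rewrite (uv _ _ ms) (uv _ _ erefl).
(* Both pairs have the same product and [u m] lies between [u t2] and [u t1], so the inner pair has
   the smaller sum. *)
have sum_le : u m + u s <= u t1 + u t2.
  have h1 : u m <= u t1 by rewrite ler_expR; lra.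
  have h2 : u t2 <= u m by rewrite ler_expR; lra.
  have : 0 <= (u t1 - u m) * (u m - u t2) by apply: mulr_ge0; lra.
  by move=> h; rewrite -(ler_pM2l um0) !mulrDr ueq; lra.
(* Total mass and mean being fixed, the new distribution is the old one plus
   the mean-preserving spread of mass eta on the top outcome. *)
pose eta := a * (u t1 + u t2 - u m - u s) / (1 - a) ^+ 2.
have eta0 : 0 <= eta by rewrite divr_ge0 ?sqr_ge0 // mulr_ge0 ?(ltW a0) //; lra.
have pp : p m * p s = p t1 * p t2 + eta.
  have -> : p m * p s = (u m * u s - a * (u m + u s) + a ^+ 2) / (1 - a) ^+ 2.
    by rewrite !pE; field; lra.
  by rewrite ueq !pE /eta; field; lra.
have sumE : p m + p s = p t1 + p t2 - eta * (1 - a) / a.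
  by rewrite !pE /eta; field; rewrite (gt_eqF a0) //=; lra.
have fin : 0 <= eta / a * (a * g0 + g2 - (1 + a) * g1).
  by apply: mulr_ge0; [exact: divr_ge0 eta0 (ltW a0) | lra].
rewrite -subr_ge0; apply: le_trans fin _; rewrite le_eqVlt; apply/predU1P; left.
set A := p m in pp sumE *; set B := p s in pp sumE *.
set A' := p t1 in pp sumE *; set B' := p t2 in pp sumE *.
transitivity ((A * B - A' * B') * g0 +
  ((A + B - 2 * (A * B)) - (A' + B' - 2 * (A' * B'))) * g1
  + (A * B - A' * B' - ((A + B) - (A' + B'))) * g2); last by ring.
by rewrite pp sumE; field; rewrite gt_eqF.
Qed.

End RandomizedResponse.

(** * Equalizing the offsets *)

Section Averaging.
Variables (R : realType) (eps : R).

Local Notation p := (p_ eps).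
Local Notation inI t := (0 <= t <= eps).

Lemma sum0_has_le0 (s : seq R) (F : R -> R) : s != [::] ->
  \sum_(t <- s) F t = 0 -> has (fun t => F t <= 0) s.
Proof.
case: s => // t s _ sum0; apply: contraT => /hasPn pos.
have Ft : 0 < F t by rewrite ltNge pos ?mem_head.
suff : 0 < \sum_(u <- t :: s) F u by rewrite sum0 ltxx.
rewrite big_cons ltr_pwDl // big_seq; apply: sumr_ge0 => u us.
by rewrite ltW // ltNge pos // in_cons us orbT.
Qed.

(** Induction on the length: exchange an offset below the mean and one above it for [m] and
    [t1 + t2 - m], then split off [m]; the rest still has mean [m]. *)
Lemma rr_div_average c n (m : R) (ts : seq R) w : 0 < eps ->
  size ts = n -> all (fun t => inI t) ts -> \sum_(t <- ts) t = n%:R * m ->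
  rr_div eps c ts w <= rr_div eps c (nseq n m) w.
Proof.
move=> eps_gt0; elim: n ts w => [|n IH] ts w.
  by move=> /size0nil -> _ _.
move=> sz tsI sumE.
have ts0 : ts != [::] by case: ts sz {tsI sumE}.
have dev0 : \sum_(t <- ts) (t - m) = 0.
  rewrite big_split /= sumE sumrN big_const_seq count_predT sz iter_addr_0
    mulr_natl.
  by rewrite subrr.
have /hasP[t1 t1ts /= t1m] := sum0_has_le0 ts0 dev0.
have /(sum0_has_le0 ts0) /hasP[t2 t2ts /= mt2] : \sum_(t <- ts) (m - t) = 0.
  by under eq_bigr do rewrite -opprB; rewrite sumrN dev0 oppr0.
have {}t1m : t1 <= m by lra.
have {}mt2 : m <= t2 by lra.
have /allP tsI' := tsI.
have t1I := tsI' _ t1ts; have t2I := tsI' _ t2ts.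
have mI : inI m by lra.
have /andP[p0 p1] := p_itv eps_gt0 mI.
have step us v : size us = n -> all (fun t => inI t) us ->
    m + \sum_(t <- us) t = n.+1%:R * m ->
    rr_div eps c (m :: us) v <= rr_div eps c (nseq n.+1 m) v.
  move=> usz usI usE.
  have usE' : \sum_(t <- us) t = n%:R * m.
    by move: usE; rewrite -natr1 mulrDl mul1r; lra.
  by apply: lerD; rewrite ler_wpM2l ?subr_ge0 // IH.
have [mts|mts] := boolP (m \in ts).
  rewrite (rr_div_rem _ _ _ mts) step //.
  - by rewrite size_rem // sz.
  - by apply/allP => t /mem_rem; exact: tsI'.
  - by rewrite -sumE (perm_big _ (perm_to_rem mts)) big_cons.
(* [t1] and [t2] are different entries: were they equal, both would be [m], which does not occur in
   [ts] in this case. *)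
have t12 : t2 \in rem t1 ts.
  have : t2 != t1.
    apply: contra mts => /eqP t21; rewrite (_ : m = t1) //; lra.
  move: t2ts; rewrite (perm_mem (perm_to_rem t1ts)) in_cons.
  by case: eqVneq.
rewrite (rr_div_rem _ _ _ t1ts).
set us := rem t2 (rem t1 ts).
have -> : rr_div eps c (t1 :: rem t1 ts) w = rr_div eps c [:: t1, t2 & us] w.
  by rewrite [LHS]/= !(fun v => rr_div_rem eps c v t12).
have usI : all (fun t => inI t) us.
  by apply/allP => t /mem_rem /mem_rem; exact: tsI'.
apply: (le_trans (rr_div_exchange c (m := m) w eps_gt0 _ usI)).
  by rewrite t1m.
apply: step => /=.
- rewrite !size_rem // sz /=.
  case: n {IH sumE} sz => //= sz; move: t12.
  by have /size0nil -> : size (rem t1 ts) = 0%N by rewrite size_rem // sz.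
- by rewrite usI andbT; lra.
- rewrite -sumE (perm_big _ (perm_to_rem t1ts)) !big_cons.
  by rewrite (perm_big _ (perm_to_rem t12)) big_cons /= -/us; lra.
Qed.

(** Grouping the outcomes by the number [i] of lower ones gives a binomial sum; the induction step
    is Pascal's rule. *)
Lemma rr_div_nseq c n t w : rr_div eps c (nseq n t) w =
  \sum_(i < n.+1) 'C(n, i)%:R * p t ^+ (n - i) * (1 - p t) ^+ i
    * Num.max (w * expR (n%:R * t - i%:R * eps) - c) 0.
Proof.
elim: n w => [|n IH] w.
  by rewrite big_ord1 /= bin0 !expr0 !mul0r subrr expR0 !mulr1 mul1r.
rewrite [LHS]/= !IH.
pose h i := Num.max (w * expR (n.+1%:R * t - i%:R * eps) - c) 0.
have h0 (i : 'I_n.+1) : w * expR t * expR (n%:R * t - i%:R * eps) =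
  w * expR (n.+1%:R * t - i%:R * eps).
  by rewrite -mulrA -expRD; congr (_ * expR _); rewrite -natr1; ring.
have h1 (i : 'I_n.+1) : w * expR (t - eps) * expR (n%:R * t - i%:R * eps) =
  w * expR (n.+1%:R * t - i.+1%:R * eps).
  by rewrite -mulrA -expRD; congr (_ * expR _); rewrite -!natr1; ring.
under eq_bigr do rewrite h0 -/(h _).
under [X in _ + _ * X]eq_bigr do rewrite h1 -/(h _).
rewrite [RHS]big_ord_recl /= /bump /=.
rewrite [X in _ = _ + X](eq_bigr
  (fun i : 'I_n.+1 => 'C(n, i.+1)%:R * p t ^+ (n - i) * (1 - p t) ^+ i.+1 *
  h i.+1
   + 'C(n, i)%:R * p t ^+ (n - i) * (1 - p t) ^+ i.+1 * h i.+1)); last first.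
  by move=> i _; rewrite add1n binS natrD subSS !mulrDl.
rewrite big_split /= addrA; congr (_ + _); last first.
  rewrite mulr_sumr; apply: eq_bigr => i _; rewrite exprS; ring.
rewrite [X in _ = _ + X]big_ord_recr /= (bin_small (ltnSn n)) !mul0r addr0.
rewrite big_ord_recl /= !bin0 !subn0 exprS mulrDr; congr (_ + _).
  by rewrite /h mul0r !expr0; ring.
rewrite mulr_sumr; apply: eq_bigr => i _; rewrite /bump /= add1n.
by rewrite -(subnSK (ltn_ord i)) (exprS (p t)); ring.
Qed.
End Averaging.

(** * The optimal common offset *)

Section Maximizer.
Variables (R : realType) (eps : R).

Local Notation p := (p_ eps).

(** As a polynomial in q, the probability that a binomial variable with k trials and success
    probability q is at most l. *)
Definition binomial_head (k l : nat) : {poly R} :=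
  \sum_(0 <= i < l.+1) ((1 - 'X) ^+ (k - i) * 'X^i *+ 'C(k, i)).

(** The derivatives of successive summands telescope; one half of the last one survives. *)
Lemma deriv_binomial_head n l : (binomial_head n.+1 l)^`() =
  - ((1 - 'X) ^+ (n - l) * 'X^l *+ (n.+1 * 'C(n, l))).
Proof.
have d m i : ((1 - 'X) ^+ m * 'X^i : {poly R})^`() =
    - (((1 - 'X) ^+ (m.-1) * 'X^i) *+ m) + ((1 - 'X) ^+ m * 'X^(i.-1)) *+ i.
  rewrite derivM deriv_exp derivB derivXn derivX derivC sub0r.
  by rewrite mulN1r mulrnAr mulNrn mulNr mulrnAl.
elim: l => [|l IH]; rewrite /binomial_head.
  by rewrite big_nat1 derivMn d !bin0 muln1 mulr0n addr0 !subn0 mulr1n.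
rewrite big_nat_recr //= derivD IH derivMn d subSS mulrnDl /= -subnS.
have e1 : ((n - l) * 'C(n.+1, l.+1) = n.+1 * 'C(n, l.+1))%N.
  by rewrite -subSS mul_bin_down.
have e2 : (l.+1 * 'C(n.+1, l.+1) = n.+1 * 'C(n, l))%N by rewrite -mul_bin_diag.
by rewrite mulNrn -!mulrnA e1 e2 addrCA addNr addr0.
Qed.

Lemma horner_binomial_head k l q : (binomial_head k l).[q] =
  \sum_(0 <= i < l.+1) 'C(k, i)%:R * (1 - q) ^+ (k - i) * q ^+ i.
Proof.
rewrite horner_sum; apply: eq_bigr => i _.
by rewrite hornerMn hornerM !horner_exp !hornerE -mulrA mulr_natl.
Qed.

(** The number of lower outcomes is binomial under both laws, with success probability
    [(1 - p t) * expR (t - eps)] under P and [1 - p t] under Q. This is P - c Q on the event that it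
    is at most l. *)
Definition trunc_div (c : R) (k l : nat) (t : R) : R :=
  (binomial_head k l).[(1 - p t) * expR (t - eps)] -
    c * (binomial_head k l).[1 - p t].

Lemma trunc_divE c k l t : 0 < eps -> (l <= k)%N -> trunc_div c k l t =
  \sum_(0 <= i < l.+1) 'C(k, i)%:R * p t ^+ (k - i) * (1 - p t) ^+ i *
    (expR (k%:R * t - i%:R * eps) - c).
Proof.
move=> eps_gt0 lk; rewrite /trunc_div !horner_binomial_head mulr_sumr -sumrB.
apply: eq_big_nat => i /andP[_ il];
  have ik : (i <= k)%N by rewrite (leq_trans _ lk).
have -> : 1 - (1 - p t) * expR (t - eps) = p t * expR t.
  by rewrite -[X in X - _](p_mean t eps_gt0) addrK.
have -> : expR (k%:R * t - i%:R * eps) =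
  expR t ^+ (k - i) * expR (t - eps) ^+ i.
  rewrite -!expRM_natl -expRD natrB //; congr expR; ring.
by rewrite subKr !exprMn; ring.
Qed.

End Maximizer.

(** * Derivative in the common offset *)

Section MaximizerDerivative.
Variables (R : realType) (eps : R).

Local Notation p := (p_ eps).
Local Notation inI t := (0 <= t <= eps).

Lemma horner_deriv_binomial_head n l (q : R) :
  (binomial_head R n.+1 l)^`().[q] =
  - (n.+1%:R * 'C(n, l)%:R * (1 - q) ^+ (n - l) * q ^+ l).
Proof.
rewrite deriv_binomial_head hornerN hornerMn hornerM !horner_exp !hornerE.
by rewrite -mulr_natl natrM !mulrA.
Qed.

(** Each tail contributes a single binomial term. The two terms differ by a likelihood ratio, so the
    sign is decided by the last factor, which changes sign once in t. *)
Lemma is_derive_trunc_div c n l (t : R) : 0 < eps ->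
  is_derive t (1 : R) (trunc_div eps c n.+1 l)
    (n.+1%:R * 'C(n, l)%:R * (1 - p t) ^+ l * p t ^+ (n - l)
     * expR (- t) / (1 - expR (- eps)) *
       (c - expR (n.+2%:R * t - l.+1%:R * eps))).
Proof.
move=> eps_gt0; have a1 := expRN_lt1 eps_gt0.
have dN : is_derive t (1 : R) (fun s => expR (- s)) (- expR (- t)).
  have h := is_derive1_comp (is_derive_expR (- t)) (is_deriveNid t (1 : R)).
  by rewrite mulrN1 in h.
set a := expR (- eps) in a1 *.
have dq : is_derive t (1 : R) (fun s => 1 - p s) (expR (- t) / (1 - a)).
  have -> : (fun s => 1 - p s) = (1 - a)^-1 \*: (cst 1 - (fun s => expR (- s))).
    apply/funext => s; rewrite /p_ /= -[(cst 1 - _) s]/(1 - expR (- s))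
      /GRing.scale /= -/a.
    by field; lra.
  have h := is_deriveZ (1 - a)^-1
    (is_deriveB (is_derive_cst (1 : R) t (1 : R)) dN).
  apply: (is_derive_eq h).
  by rewrite /GRing.scale /= sub0r opprK mulrC.
have dq' : is_derive t (1 : R) (fun s => (1 - p s) * expR (s - eps))
  (a * expR t / (1 - a)).
  have -> : (fun s => (1 - p s) * expR (s - eps)) =
    (a / (1 - a)) \*: (expR - cst 1).
    apply/funext => s; rewrite /p_ /= -[(expR - cst 1) s]/(expR s - 1)
      /GRing.scale /= expRD (expRN s) -/a.
    have s0 := expR_gt0 s.
    by field; rewrite gt_eqF //=; lra.
  have h := is_deriveZ (a / (1 - a))
    (is_deriveB (is_derive_expR t) (is_derive_cst (1 : R) t (1 : R))).
  apply: (is_derive_eq h).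
  by rewrite /GRing.scale /= subr0 mulrAC.
have h1 := is_derive1_comp (is_derive_poly (binomial_head R n.+1 l) _) dq'.
have h2 := is_deriveZ c (is_derive1_comp
  (is_derive_poly (binomial_head R n.+1 l) _) dq).
apply: (is_derive_eq (is_deriveB h1 h2)).
rewrite !horner_deriv_binomial_head.
(* For l >= n + 1 both tails are full binomial expansions, hence constant, and ['C(n, l)] is 0. *)
have [nl|ln] := ltnP n l.
  by rewrite bin_small // !(mulr0, mul0r, oppr0) scaler0 subrr.
have -> : 1 - (1 - p t) * expR (t - eps) = p t * expR t.
  by rewrite -[X in X - _](p_mean t eps_gt0) addrK.
have -> : expR (n.+2%:R * t - l.+1%:R * eps) =
    expR t ^+ (n - l) * expR (t - eps) ^+ l * a * expR t * expR t.
  rewrite -!expRM_natl -!expRD natrB //; congr expR.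
  by rewrite -!natr1; ring.
rewrite subKr /GRing.scale /= expRN; move: (p t) => P; rewrite !exprMn.
have t0 := expR_gt0 t; field; rewrite gt_eqF //=; lra.
Qed.

(** By the mean value theorem: the function increases up to [u], the zero of the last factor of the
    derivative, and decreases after it; [t_star] is the point of [0, eps] nearest to [u]. *)
Lemma trunc_div_le_t_star epsg k l (t : R) : 0 < eps -> (0 < k)%N -> inI t ->
  trunc_div eps (expR epsg) k l t <=
  trunc_div eps (expR epsg) k l (t_star eps epsg k l).
Proof.
case: k => // n eps_gt0 _ /andP[t0 te].
have a1 := expRN_lt1 eps_gt0.
set c := expR epsg.
pose pos (s : R) := n.+1%:R * 'C(n, l)%:R * (1 - p s) ^+ l * p s ^+ (n - l)
  * expR (- s) / (1 - expR (- eps)).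
have pos_ge0 (s : R) : inI s -> 0 <= pos s.
  move=> /(p_itv eps_gt0) /andP[p0 p1].
  rewrite /pos divr_ge0 ?subr_ge0 ?(ltW a1) // mulr_ge0 ?expR_ge0 //.
  by rewrite !mulr_ge0 ?exprn_ge0 ?subr_ge0.
have D s : is_derive s (1 : R) (trunc_div eps c n.+1 l)
    (pos s * (c - expR (n.+2%:R * s - l.+1%:R * eps))).
  exact: is_derive_trunc_div.
have cont (x y : R) : {within `[x, y],
  continuous (trunc_div eps c n.+1 l)}%classic.
  apply: derivable_within_continuous => s _.
  by have [] := D s.
set u := (epsg + l.+1%:R * eps) / n.+2%:R.
have uE (s : R) : (expR (n.+2%:R * s - l.+1%:R * eps) <= c) = (s <= u).
  by rewrite ler_expR /u ler_pdivlMr ?ltr0n // lerBlDr (mulrC s).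
have uE' (s : R) : (c <= expR (n.+2%:R * s - l.+1%:R * eps)) = (u <= s).
  by rewrite ler_expR /u ler_pdivrMr ?ltr0n // lerBrDr (mulrC s).
have -> : t_star eps epsg n.+1 l =
  if u < 0 then 0 else if eps < u then eps else u by [].
set v := (if _ then _ else _).
have vI : inI v.
  by rewrite /v; case: (ltP u 0) => h1; [|case: (ltP eps u) => h2]; lra.
have [tv|vt|->//] := ltgtP t v.
  have [s /=] := MVT tv (fun x _ => D x) (cont t v).
  rewrite in_itv /= => /andP[ts sv] E.
  rewrite -subr_ge0 E mulr_ge0 ?subr_ge0 ?(ltW tv) //.
  apply: mulr_ge0; first by apply: pos_ge0; lra.
  (* Since [0 <= t < v], the point [v] was not raised to 0 by the clamping; hence [v <= u], and
     [s < v] gives [s <= u]. *)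
  rewrite subr_ge0 uE; move: tv sv.
  by rewrite /v; case: (ltP u 0) => h1; [|case: (ltP eps u) => h2]; lra.
have [s /=] := MVT vt (fun x _ => D x) (cont v t).
rewrite in_itv /= => /andP[ts sv] E.
rewrite -subr_le0 E mulr_le0_ge0 ?subr_ge0 ?(ltW vt) //.
apply: mulr_ge0_le0; first by apply: pos_ge0; lra.
rewrite subr_le0 uE'; move: vt ts.
by rewrite /v; case: (ltP u 0) => h1; [|case: (ltP eps u) => h2]; lra.
Qed.
End MaximizerDerivative.

(** * From truncated sums to the formula *)

Section DeltaFormula.
Variables (R : realType) (eps : R).

Local Notation p := (p_ eps).
Local Notation inI t := (0 <= t <= eps).

(** As [e] is nonincreasing, the indices with [c < e i] form an initial segment; the first
    alternative is the empty segment. *)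
Lemma sum_max_antitone (w e : nat -> R) c n :
  {homo e : i j / (i <= j)%N >-> j <= i} ->
  \sum_(0 <= i < n) w i * Num.max (e i - c) 0 = 0 \/
  exists2 l, (l < n)%N & \sum_(0 <= i < n) w i * Num.max (e i - c) 0 =
                        \sum_(0 <= i < l.+1) w i * (e i - c).
Proof.
move=> e_anti; elim: n => [|n IH]; first by left; rewrite big_geq.
have [en|en] := leP (e n) c; last first.
  right; exists n => //; apply: eq_big_nat => i /andP[_ lin].
  by rewrite max_l // subr_ge0 (le_trans (ltW en)) ?e_anti.
rewrite big_nat_recr //= max_r ?subr_le0 // mulr0 addr0.
by case: IH => [|[l ln]]; [left | right; exists l => //; exact: ltnW].
Qed.

Lemma t_star_itv epsg k l : 0 < eps -> inI (t_star eps epsg k l).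
Proof.
move=> eps_gt0; rewrite /t_star; set u := _ / _.
by case: (ltP u 0) => h1; [|case: (ltP eps u) => h2]; lra.
Qed.

Lemma delta_termE epsg k l : delta_term eps epsg k l =
  rr_div eps (expR epsg) (nseq k (t_star eps epsg k l)) 1.
Proof. by rewrite rr_div_nseq; apply: eq_bigr => i _; rewrite mul1r. Qed.

Lemma rr_div_ge0 c (ts : seq R) w : 0 < eps -> all (fun t => inI t) ts ->
  0 <= rr_div eps c ts w.
Proof.
move=> eps_gt0; elim: ts w =>
  [|t ts IH] w /=; first by rewrite le_max lexx orbT.
move=> /andP[/(p_itv eps_gt0) /andP[p0 p1] tsI].
by rewrite addr_ge0 // mulr_ge0 ?IH // subr_ge0.
Qed.

Lemma delta_term_ge0 epsg k l : 0 < eps -> 0 <= delta_term eps epsg k l.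
Proof.
move=> eps_gt0; rewrite delta_termE rr_div_ge0 //.
by rewrite all_nseq t_star_itv ?orbT.
Qed.

(** Taking positive parts and adding the terms beyond l can only increase the sum. *)
Lemma trunc_div_le_delta_term epsg k l : 0 < eps -> (l <= k)%N ->
  trunc_div eps (expR epsg) k l (t_star eps epsg k l) <=
    delta_term eps epsg k l.
Proof.
move=> eps_gt0 lk; rewrite trunc_divE // /delta_term.
have /(p_itv eps_gt0) /andP[p0 p1] := t_star_itv epsg k l eps_gt0.
set t := t_star _ _ _ _ in p0 p1 *.
rewrite -(big_mkord predT (fun i =>
  'C(k, i)%:R * p t ^+ (k - i) * (1 - p t) ^+ i *
  Num.max (expR (k%:R * t - i%:R * eps) - expR epsg) 0)).
rewrite [leRHS](@big_cat_nat _ _ _ l.+1) //= -[leLHS]addr0 lerD //.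
  apply: ler_sum => i _; apply: ler_wpM2l; last by rewrite le_max lexx.
  by rewrite !mulr_ge0 ?exprn_ge0 ?subr_ge0.
apply: sumr_ge0 => i _.
by rewrite !mulr_ge0 ?exprn_ge0 ?subr_ge0 // le_max lexx orbT.
Qed.

(** Unless it is 0, the sum of positive parts at [t] equals some truncated sum, which does not
    decrease when [t] is moved to the offset optimal for that truncation. *)
Lemma rr_div_le_delta_formula epsg k (t : R) : 0 < eps -> (0 < k)%N -> inI t ->
  rr_div eps (expR epsg) (nseq k t) 1 <= delta_formula eps epsg k.
Proof.
move=> eps_gt0 k_gt0 tI; rewrite rr_div_nseq.
have bound l : (l < k.+1)%N ->
  delta_term eps epsg k l <= delta_formula eps epsg k.
  by move=> lk; rewrite /delta_formula (bigmax_sup (Ordinal lk)).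
under eq_bigr do rewrite mul1r.
rewrite -(big_mkord predT (fun i =>
  'C(k, i)%:R * p t ^+ (k - i) * (1 - p t) ^+ i *
  Num.max (expR (k%:R * t - i%:R * eps) - expR epsg) 0)).
have e_anti : {homo (fun i => expR (k%:R * t - i%:R * eps)) :
  i j / (i <= j)%N >-> j <= i}.
  by move=> i j ij; rewrite ler_expR lerD2l lerN2 ler_pM2r // ler_nat.
case: (sum_max_antitone (fun i =>
  'C(k, i)%:R * p t ^+ (k - i) * (1 - p t) ^+ i) (expR epsg) k.+1 e_anti) =>
  [|[l lk]] /= ->.
  exact: le_trans (delta_term_ge0 _ _ 0 eps_gt0) (bound 0%N _).
rewrite -trunc_divE //; apply: le_trans (bound l lk).
exact: le_trans (trunc_div_le_t_star _ _ eps_gt0 k_gt0 tI)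
  (trunc_div_le_delta_term _ eps_gt0 _).
Qed.

Lemma delta_formula_attained epsg k : exists l,
  delta_formula eps epsg k = delta_term eps epsg k l.
Proof.
rewrite /delta_formula; elim/big_ind: _ => [|x y [i ->] [j ->]|i _].
- by exists 0%N.
- by rewrite /Num.max; case: ifP => _; [exists j | exists i].
- by exists i.
Qed.

End DeltaFormula.

(** * Bounded-range mechanisms *)

Section Density.
Context d (T : measurableType d) (R : realType).
Variables (mu P : {measure set T -> \bar R}) (f : T -> R).
Hypotheses (mf : measurable_fun setT f) (f_ge0 : forall y, 0 <= f y).
Hypothesis P_density : forall A, measurable A ->
  P A = (\int[mu]_(y in A) (f y)%:E)%E.

Import HBNNSimple.

Let mEf : measurable_fun setT (fun y => (f y)%:E).
Proof. exact/measurable_EFinP. Qed.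

Let integral_density_nnsfun (g : {nnsfun T >-> R}) :
  (\int[P]_y (g y)%:E = \int[mu]_y ((g y)%:E * (f y)%:E))%E.
Proof.
under [LHS]eq_integral do rewrite fimfunE -fsumEFin//.
rewrite [LHS]ge0_integral_fsum//; last 2 first.
  - by move=> r; exact/measurable_EFinP/measurableT_comp.
  - by move=> n x _; rewrite EFinM nnfun_muleindic_ge0.
under [RHS]eq_integral.
  move=> x _; rewrite fimfunE -fsumEFin// muleC ge0_mule_fsumr; last first.
    by move=> r; rewrite EFinM nnfun_muleindic_ge0.
  over.
rewrite [RHS]ge0_integral_fsum//; last 2 first.
  - move=> r; apply: emeasurable_funM => //.
    by apply/measurable_EFinP; apply: measurableT_comp.
  - by move=> n x _; rewrite mule_ge0 ?lee_fin// -lee_fin EFinM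
      nnfun_muleindic_ge0.
apply: eq_fsbigr => r _.
rewrite integralZl_indic_nnsfun// integral_indic//= setIT P_density//.
rewrite [X in (_ * X)%E]integral_mkcond epatch_indic.
have mpre : measurable (g @^-1` [set r])%classic by exact: measurable_funPTI.
(* A negative level has an empty preimage under the nonnegative [g], and both sides vanish. *)
have [r0|r_lt0] := leP 0 r.
  rewrite -ge0_integralZl ?lee_fin//=.
  - by apply: eq_integral => y _; rewrite EFinM muleCA.
  - apply: emeasurable_funM => //; exact/measurable_EFinP/measurable_indic.
  - by move=> y _; rewrite mule_ge0 ?lee_fin// f_ge0.
have -> : (g @^-1` [set r])%classic = set0.
  by rewrite -subset0 => y /= gyr; move: r_lt0; rewrite -gyr ltNge fun_ge0.
rewrite !integral0_eq ?mule0// => y _ /=; rewrite indic0 ?mulr0 mule0//.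
Qed.

(** Simple functions reduce to the density property on sets; monotone convergence on both sides does
    the rest, for an arbitrary measure [mu]. *)
Lemma integral_density (g : T -> \bar R) :
  measurable_fun setT g -> (forall y, 0 <= g y)%E ->
  (\int[P]_y g y = \int[mu]_y (g y * (f y)%:E))%E.
Proof.
move=> mg g0.
pose g_ := nnsfun_approx measurableT mg.
transitivity (limn (fun n => \int[P]_y (g_ n y)%:E)%E).
  rewrite -monotone_convergence//=.
  - apply: eq_integral => y _; apply/esym/cvg_lim => //=.
    exact: cvg_nnsfun_approx.
  - by move=> n; exact/measurable_EFinP/measurable_funTS.
  - by move=> n y _; rewrite lee_fin.
  - by move=> y _ m n mn; rewrite lee_fin; exact/lefP/nd_nnsfun_approx.
under eq_fun do rewrite integral_density_nnsfun.
rewrite -monotone_convergence//=.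
- apply: eq_integral => y _; apply/cvg_lim => //=.
  apply: cvgeZr => //; exact: cvg_nnsfun_approx.
- by move=> n; apply: emeasurable_funM =>
    //; exact/measurable_EFinP/measurable_funTS.
- by move=> n y _; rewrite mule_ge0 ?lee_fin.
- move=> y _ m n mn; apply: lee_wpmul2r; rewrite ?lee_fin//.
  exact/lefP/nd_nnsfun_approx.
Qed.
End Density.

(** * One bounded-range factor against randomized response *)

Section BoundedRangeStep.
Context d (T : measurableType d) (R : realType).
Variables (mu : {measure set T -> \bar R}) (P Q : probability T R)
  (f g : T -> R).
Variable eps : R.
Hypotheses (mf : measurable_fun setT f) (mg : measurable_fun setT g).
Hypotheses (f_ge0 : forall y, 0 <= f y) (g_ge0 : forall y, 0 <= g y).
Hypothesis Pf : forall A, measurable A -> P A = (\int[mu]_(y in A) (f y)%:E)%E.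
Hypothesis Qg : forall A, measurable A -> Q A = (\int[mu]_(y in A) (g y)%:E)%E.

Local Notation inI t := (0 <= t <= eps).

Let intf1 : (\int[mu]_y (f y)%:E = 1)%E.
Proof. by rewrite -Pf ?probability_setT. Qed.

Let intg1 : (\int[mu]_y (g y)%:E = 1)%E.
Proof. by rewrite -Qg ?probability_setT. Qed.

Let mEf : measurable_fun setT (fun y => (f y)%:E).
Proof. exact/measurable_EFinP. Qed.

Let mEg : measurable_fun setT (fun y => (g y)%:E).
Proof. exact/measurable_EFinP. Qed.

(** [expR t] is the supremum [b] of the likelihood ratio f / g. Bounded range puts every ratio above
    [expR (- eps) * b]; integrating both bounds, with f and g of total mass 1, gives
    [1 <= b <= expR eps]. *)
Lemma bounded_range_offset :
  (forall y1 y2, f y1 * g y2 <= expR eps * (f y2 * g y1)) ->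
  exists2 t : R, inI t &
    forall y, f y <= expR t * g y /\ expR (t - eps) * g y <= f y.
Proof.
move=> br.
have [y0 gy0] : exists y0, 0 < g y0.
  apply: contrapT => /forallNP g0; move: intg1.
  rewrite integral0_eq; first by move=> /eqP; rewrite eq_sym onee_eq0.
  move=> y _; congr (_%:E); apply/eqP; rewrite eq_le g_ge0 andbT leNgt.
  exact/negP.
pose S := [set f y / g y | y in [set y | 0 < g y]]%classic.
have S0 : (S !=set0)%classic by exists (f y0 / g y0), y0.
have S_ub y : 0 < g y -> ubound S (expR eps * (f y / g y)).
  move=> gy _ [y1 /= gy1 <-];
    rewrite ler_pdivrMr // mulrA mulrAC ler_pdivlMr //.
  by rewrite (le_trans (br y1 y)) // mulrA.
have S_sup : has_sup S by split=> //; exists (expR eps * (f y0 / g y0));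
  exact: S_ub.
pose b := sup S.
(* Where g vanishes so does f, by the cross-multiplied bound against [y0]. *)
have fg0 y : g y = 0 -> f y = 0.
  move=> gy; have := br y y0; rewrite gy !mulr0 => h.
  by apply/eqP; rewrite eq_le f_ge0 andbT -(pmulr_lle0 _ gy0).
have f_le y : f y <= b * g y.
  have := g_ge0 y; rewrite le_eqVlt => /predU1P[gy|gy].
    by rewrite -gy fg0 ?mulr0.
  by rewrite -ler_pdivrMr //; apply: ub_le_sup; [case: S_sup | exists y].
have f_ge y : expR (- eps) * b * g y <= f y.
  have := g_ge0 y; rewrite le_eqVlt => /predU1P[gy|gy].
    by rewrite -gy mulr0 f_ge0.
  rewrite -ler_pdivlMr // expRN ler_pdivrMl ?expR_gt0 //.
  by apply: ge_sup => //; exact: S_ub.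
have b_ge1 : 1 <= b.
  rewrite -lee_fin -intf1.
  apply: (@le_trans _ _ (\int[mu]_y (b%:E * (g y)%:E))%E).
    apply: ge0_le_integral => //.
    - by move=> y _; rewrite lee_fin.
    - exact: measurable_funeM.
    - by move=> y _; rewrite -EFinM lee_fin.
  have b0 : 0 <= b.
    rewrite -(pmulr_lge0 _ gy0) (le_trans _ (f_le _)) //.
  by rewrite ge0_integralZl_EFin // ?intg1 ?mule1 // => y _; rewrite lee_fin.
have b_le : b <= expR eps.
  have b0 : 0 <= b by lra.
  rewrite -[leRHS]mulr1 -ler_pdivrMl ?expR_gt0 // -expRN -lee_fin -[leRHS]intf1.
  apply: (@le_trans _ _ (\int[mu]_y ((expR (- eps) * b)%:E * (g y)%:E))%E).
    rewrite ge0_integralZl_EFin // ?intg1 ?mule1 // => [y _|].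
      by rewrite lee_fin.
    by rewrite mulr_ge0 ?expR_ge0.
  apply: ge0_le_integral => //.
  - by move=> y _; rewrite -EFinM lee_fin !mulr_ge0 ?expR_ge0.
  - exact: measurable_funeM.
  - by move=> y _; rewrite lee_fin.
have lnb : expR (ln b) = b by rewrite lnK // posrE; lra.
exists (ln b).
  by rewrite ln_ge0 //= -ler_expR lnb.
by move=> y; rewrite expRD lnb; split=> //; rewrite (mulrC b).
Qed.

Let integrable_density (h A : T -> R) :
  measurable_fun setT h -> (forall y, 0 <= h y) ->
  (\int[mu]_y (h y)%:E = 1)%E ->
  measurable_fun setT A -> (forall y, 0 <= A y <= 1) ->
  mu.-integrable setT (EFin \o (fun y => A y * h y)).
Proof.
move=> mh h0 h1 mA A01; apply/integrableP; split.
  by apply/measurable_EFinP; exact: measurable_funM.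
apply: (@le_lt_trans _ _ (\int[mu]_y (h y)%:E)%E); last by rewrite h1 ltry.
apply: ge0_le_integral => //.
- by apply: measurableT_comp =>
    //; apply/measurable_EFinP; exact: measurable_funM.
- exact/measurable_EFinP.
- move=> y _ /=; have /andP[A0 A1] := A01 y.
  by rewrite lee_fin ger0_norm ?mulr_ge0 // ler_piMl.
Qed.

(** Replaces one factor by randomized response. [A y] and [B y] stand for the probabilities, under
    the two neighbors, of the section of an event at outcome y of this factor; the other factors are
    already bounded by [rr_div eps c ts], at the weight multiplied by f / g. *)
Lemma rr_div_step c t (ts : seq R) w (A B : T -> R) : 0 < eps ->
  all (fun s => inI s) ts ->
  (forall y, f y <= expR t * g y /\ expR (t - eps) * g y <= f y) ->
  measurable_fun setT A -> measurable_fun setT B ->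
  (forall y, 0 <= A y <= 1) -> (forall y, 0 <= B y <= 1) ->
  (forall v y, v * A y - c * B y <= rr_div eps c ts v) ->
  w * fine (\int[P]_y (A y)%:E)%E - c * fine (\int[Q]_y (B y)%:E)%E <=
  rr_div eps c (t :: ts) w.
Proof.
move=> eps_gt0 tsI ft mA mB A01 B01 AB.
have A0 y : 0 <= A y by case/andP: (A01 y).
have B0 y : 0 <= B y by case/andP: (B01 y).
rewrite (integral_density mf f_ge0 Pf); last 2 first.
  - exact/measurable_EFinP.
  - by move=> y; rewrite lee_fin.
rewrite (integral_density mg g_ge0 Qg); last 2 first.
  - exact/measurable_EFinP.
  - by move=> y; rewrite lee_fin.
pose x0 := expR (t - eps); pose x1 := expR t.
have x01 : x0 < x1 by rewrite ltr_expR; lra.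
pose h x := rr_div eps c ts (w * x).
pose beta := (h x1 - h x0) / (x1 - x0).
pose alpha := h x0 - beta * x0.
(* Since P and Q both have mass 1, the chord of the convex h integrates to its
   two-point mean. *)
have chord x : x0 <= x <= x1 -> h x <= alpha + beta * x.
  move=> /andP[x0x xx1].
  pose l := (x - x0) / (x1 - x0).
  have l01 : 0 <= l <= 1.
    by rewrite /l divr_ge0 ?ler_pdivrMr ?mul1r; lra.
  have := rr_div_convex c (w * x1) (w * x0) eps_gt0 tsI l01.
  have -> : l * (w * x1) + (1 - l) * (w * x0) = w * x.
    by rewrite /l; field; lra.
  rewrite -/(h _) -/(h _) -/(h _) => /le_trans; apply.
  rewrite le_eqVlt; apply/predU1P; left.
  by rewrite /alpha /beta /l; field; lra.
have pointwise y : w * (A y * f y) - c * (B y * g y) <=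
  alpha * g y + beta * f y.
  have [fl fu] := ft y.
  have := g_ge0 y; rewrite le_eqVlt => /predU1P[gy|gy].
    move: fl; rewrite -gy mulr0 => fl.
    have -> : f y = 0 by apply/eqP; rewrite eq_le fl f_ge0.
    by rewrite !(mulr0, subr0, addr0).
  have -> : w * (A y * f y) - c * (B y * g y) =
    g y * (w * (f y / g y) * A y - c * B y).
    by field; lra.
  have -> : alpha * g y + beta * f y = g y * (alpha + beta * (f y / g y)).
    by field; lra.
  rewrite ler_pM2l //; apply: le_trans (AB _ _) (chord _ _).
  by rewrite ler_pdivlMr // fu ler_pdivrMr.
have one01 y : (0 <= (cst 1 : T -> R) y <= 1) by rewrite /= ler01 lexx.
have iA := integrable_density mf f_ge0 intf1 mA A01.
have iB := integrable_density mg g_ge0 intg1 mB B01.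
have if1 := integrable_density mf f_ge0 intf1 (measurable_cst _) one01.
have ig1 := integrable_density mg g_ge0 intg1 (measurable_cst _) one01.
have iZ (k : R) (u : T -> R) : mu.-integrable setT (EFin \o u) ->
    mu.-integrable setT (EFin \o (fun y => k * u y)).
  by move=> iu; rewrite (_ : EFin \o _ = (fun y => k%:E * (EFin \o u) y)%E) //;
    exact: integrableZl.
(* The right side is the chord at 1, and by [p_mean] the endpoints average to 1 under the two-point
   law. *)
have -> : rr_div eps c (t :: ts) w = alpha + beta.
  rewrite /= -/x0 -/x1 -/(h x0) -/(h x1) /alpha.
  have := p_mean t eps_gt0; rewrite -/x0 -/x1 => pm.
  have -> : h x0 - beta * x0 + beta =
    h x0 + beta * (p_ eps t * x1 + (1 - p_ eps t) * x0 - x0).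
    by rewrite pm; ring.
  by rewrite /beta; field; lra.
have RE (u v : T -> R) : fine (\int[mu]_y ((u y)%:E * (v y)%:E))%E =
  \int[mu]_y (u y * v y).
  by [].
rewrite !RE -!RintegralZl // -RintegralB //; try exact: iZ.
have f1 : mu.-integrable setT (EFin \o f).
  by move: if1; under eq_fun do rewrite /= mul1r.
have g1 : mu.-integrable setT (EFin \o g).
  by move: ig1; under eq_fun do rewrite /= mul1r.
have -> : alpha + beta = \int[mu]_y (alpha * g y + beta * f y).
  rewrite RintegralD //; try exact: iZ.
  by rewrite !RintegralZl // /Rintegral intf1 intg1 !mulr1.
apply: le_Rintegral => //.
- by apply: (integrableB measurableT (iZ _ _ iA) (iZ _ _ iB)).
- by apply: (integrableD measurableT (iZ _ _ g1) (iZ _ _ f1)).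
Qed.
End BoundedRangeStep.

(** * Upper bound for compositions *)

Section CompositionUpperBound.
Variables (R : realType) (X : Type) (nb : X -> X -> Prop) (eps : R).
Hypothesis eps_gt0 : 0 < eps.

Local Notation inI t := (0 <= t <= eps).

(** Uniqueness of the product measure exchanges the order of integration: the last factor is
    integrated outermost, as the left-nested [composition] requires. *)
Lemma product_probability_ysection d1 d2 (T1 : measurableType d1)
    (T2 : measurableType d2) (P1 : probability T1 R) (P2 : probability T2 R)
    (S : set (T1 * T2)) : measurable S ->
  ((P1 \x P2)%E S = \int[P2]_y (fine (P1 (ysection S y)))%:E)%E.
Proof.
move=> mS.
rewrite (product_measure_unique (m' := (P1 \x^ P2)%E)) //; last first.
  by move=> A B mA mB; exact: product_measure2E.
apply: eq_integral => y _ /=; rewrite fineK //.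
by apply: fin_num_measure; exact: measurable_ysection.
Qed.

Lemma fine_prob_itv d (T : measurableType d) (P : probability T R) (A : set T) :
  measurable A -> 0 <= fine (P A) <= 1.
Proof.
move=> mA; rewrite fine_ge0 //= -lee_fin fineK ?probability_le1 //.
exact: fin_num_measure.
Qed.

(** Induction with the last mechanism integrated outermost: its outcome y multiplies the weight by a
    likelihood ratio and leaves the section of S at y to the earlier factors. The offsets are
    therefore chosen before S and w. *)
Lemma composition_rr_div_le (M : nat -> mechanism R X) (c : R) n x x' :
  nb x x' -> (forall i, (i < n.+1)%N -> bounded_range nb eps (M i)) ->
  exists ts : seq R, [/\ size ts = n.+1, all (fun t => inI t) ts &
    forall S w, measurable S ->
      w * fine (law (composition M n) x S) -
        c * fine (law (composition M n) x' S)
      <= rr_div eps c ts w].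
Proof.
move=> xx'; elim: n => [|n IH] br.
  have [mu [f [fP /(_ _ _ xx') fbr]]] := br 0%N (ltnSn _).
  have [mfx fx0 fxE] := fP x; have [mfx' fx'0 fx'E] := fP x'.
  have [t tI ft] := bounded_range_offset mfx mfx' fx0 fx'0 fxE fx'E fbr.
  exists [:: t]; split => //; first by rewrite /= tI.
  move=> S w mS.
  (* With a single factor the section probabilities are the indicator of S. *)
  have E (P : probability (outcome (M 0%N)) R) :
    P S = (\int[P]_y (\1_S y)%:E)%E.
    by rewrite integral_indic // setIT.
  rewrite (E (law (M 0%N) x)) (E (law (M 0%N) x')).
  have mI : measurable_fun setT (\1_S : outcome (M 0%N) -> R).
    exact: measurable_indic.
  have I01 y : 0 <= (\1_S y : R) <= 1.
    by rewrite indicE; case: (y \in S) => /=; rewrite lexx ler01.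
  have H := rr_div_step mfx mfx' fx0 fx'0 fxE fx'E (c := c) (ts := [::]) w
    eps_gt0 isT ft mI mI I01 I01.
  apply: H.
  move=> v y /=; rewrite indicE le_max; case: (y \in S) => /=.
    by rewrite !mulr1 lexx.
  by rewrite !mulr0 subrr lexx orbT.
have [ts [sz tsI IHts]] := IH (fun i ilt => br i (ltnW ilt)).
have [mu [f [fP /(_ _ _ xx') fbr]]] := br n.+1 (ltnSn _).
have [mfx fx0 fxE] := fP x; have [mfx' fx'0 fx'E] := fP x'.
have [t tI ft] := bounded_range_offset mfx mfx' fx0 fx'0 fxE fx'E fbr.
exists (t :: ts); split; first by rewrite /= sz.
  by rewrite /= tI.
move=> S w mS.
have lawE z : (law (composition M n.+1) z S =
    \int[law (M n.+1) z]_y (fine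
      (law (composition M n) z (ysection S y)))%:E)%E.
  exact: product_probability_ysection.
rewrite !lawE.
have msec z : measurable_fun setT
  (fun y => fine (law (composition M n) z (ysection S y))).
  by apply: measurableT_comp => //; exact: measurable_fun_ysection.
have sec01 z y : 0 <= fine (law (composition M n) z (ysection S y)) <= 1.
  by apply: fine_prob_itv; exact: measurable_ysection.
apply: (rr_div_step mfx mfx' fx0 fx'0 fxE fx'E w eps_gt0 tsI ft (msec x)
  (msec x') (sec01 x) (sec01 x')).
by move=> v y; apply: IHts; exact: measurable_ysection.
Qed.
End CompositionUpperBound.

(** * Randomized response as a mechanism *)

Section RandomizedResponseMechanism.
Variables (R : realType) (X : Type) (nb : X -> X -> Prop) (eps : R).
Hypothesis eps_gt0 : 0 < eps.

Local Notation p := (p_ eps).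
Local Notation inI t := (0 <= t <= eps).

(** The probability of [true]: input [x0] gets the law P tilted by the likelihood ratio, every other
    input the law Q. *)
Definition rr_param (t : R) (x0 x : X) : R :=
  if `[< x = x0 >] then p t * expR t else p t.

Definition rr_mechanism (t : R) (x0 : X) : mechanism R X :=
  @Mechanism R X _ bool (fun x =>
    bernoulli_prob (rr_param t x0 x) : probability bool R).

Lemma rr_param_itv t x0 x : inI t -> 0 <= rr_param t x0 x <= 1.
Proof.
move=> tI; rewrite /rr_param; have /andP[p0 p1] := p_itv eps_gt0 tI.
case: ifP => _; last by rewrite p0.
rewrite mulr_ge0 ?expR_ge0 //= -(p_mean t eps_gt0) lerDl mulr_ge0 ?expR_ge0 //.
by rewrite subr_ge0.
Qed.

Lemma rr_mechanism_bounded_range t x0 : inI t ->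
  bounded_range nb eps (rr_mechanism t x0).
Proof.
move=> tI; have /andP[p0 p1] := p_itv eps_gt0 tI.
(* Against the uniform law on bool as reference measure, the density is twice the mass function. *)
exists (bernoulli_prob 2^-1),
  (fun x b => 2 * bernoulli_pmf (rr_param t x0 x) b); split.
  move=> x; have r01 := rr_param_itv x0 x tI; split.
  - by apply: measurable_funM => //; exact: measurable_cst.
  - by move=> b; rewrite mulr_ge0 ?bernoulli_pmf_ge0.
  - move=> A mA; rewrite integral_mkcond integral_bernoulli_prob; last first.
    + move=> b; rewrite patchE; case: ifP => // _.
      by rewrite lee_fin mulr_ge0 ?bernoulli_pmf_ge0.
    + by rewrite invr_ge0 ler0n invf_le1 ?ler1n.
    rewrite /= bernoulli_probE //= !diracE !patchE.
    have -> : unstable.onem (2^-1 : R) = 2^-1 by rewrite /unstable.onem; lra.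
    by case: (true \in A); case: (false \in A) =>
      /=; rewrite ?mule1 ?mule0 -?EFinM ?mulKf ?pnatr_eq0 ?mule0.
move=> x x' _ b1 b2.
pose rho b := expR (if b then t else t - eps).
pose lr z b := if `[< z = x0 >] then rho b else 1.
have pmfE z b : bernoulli_pmf (rr_param t x0 z) b =
  bernoulli_pmf (p t) b * lr z b.
  rewrite /rr_param /lr /rho; case: asboolP => _; last by rewrite mulr1.
  by case: b => //=; rewrite -{1}(p_mean t eps_gt0) addrC addKr.
have e1 : 1 <= expR eps by rewrite -expR0 ler_expR ltW.
have rho0 b : 0 < rho b := expR_gt0 _.
have rho_le b b' : rho b <= expR eps * rho b'.
  by rewrite /rho -expRD ler_expR; case: b; case: b'; lra.
have lr0 z b : 0 < lr z b by rewrite /lr; case: ifP.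
have lr_le : lr x b1 * lr x' b2 <= expR eps * (lr x b2 * lr x' b1).
  rewrite /lr; case: ifP => _; case: ifP => _.
  - by rewrite mulrC ler_peMl // mulr_ge0 // ltW.
  - by rewrite !mulr1.
  - by rewrite !mul1r.
  - by rewrite !mulr1.
have := bernoulli_pmf_ge0 (p := p t) b1;
  have := bernoulli_pmf_ge0 (p := p t) b2.
rewrite p0 p1 => /(_ isT) g2 /(_ isT) g1.
(* The 4 is the product of the factors 2 of the two densities. *)
have := ler_wpM2l (mulr_ge0 (ler0n _ 4) (mulr_ge0 g1 g2)) lr_le.
rewrite !pmfE; move: (bernoulli_pmf _ _) (bernoulli_pmf _ _) => m1 m2.
move: (lr _ _) (lr _ _) (lr _ _) (lr _ _) => l1 l2 l3 l4.
by move=> h; apply: le_trans (le_trans _ h) _; rewrite le_eqVlt; apply/predU1P;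
  left; ring.
Qed.

(** The event is a Neyman-Pearson test: the outcomes whose weighted likelihood ratio exceeds c. It
    is assembled from its two sections, since the last coordinate only rescales the weight for the
    others. *)
Lemma rr_mechanism_attains t x0 x1 c n w : inI t -> x1 <> x0 ->
  exists2 S, measurable S &
    w * fine (law (composition (fun=> rr_mechanism t x0) n) x0 S) -
    c * fine (law (composition (fun=> rr_mechanism t x0) n) x1 S)
    = rr_div eps c (nseq n.+1 t) w.
Proof.
move=> tI x10.
have r0 : rr_param t x0 x0 = p t * expR t by rewrite /rr_param asboolT.
have r1 : rr_param t x0 x1 = p t by rewrite /rr_param asboolF.
have pe : 1 - p t * expR t = (1 - p t) * expR (t - eps).
  by rewrite -{1}(p_mean t eps_gt0) addrC addKr.
elim: n w => [|n IH] w.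
  pose S := [set b : bool | c < w * expR (if b then t else t - eps)]%classic.
  exists S => //.
  have lawE z : fine (law (composition (fun=> rr_mechanism t x0) 0) z S) =
     rr_param t x0 z * (true \in S)%:R +
       (1 - rr_param t x0 z) * (false \in S)%:R.
    by rewrite /= bernoulli_probE ?rr_param_itv // !diracE.
  rewrite !lawE r0 r1 pe.
  have SE b : ((b \in S)%:R * (w * expR (if b then t else t - eps) - c)) =
    Num.max (w * expR (if b then t else t - eps) - c) 0.
    have [h|h] := ltP c (w * expR (if b then t else t - eps)).
      by rewrite mem_set // mul1r max_l // subr_ge0 ltW.
    by rewrite memNset ?mul0r ?max_r ?subr_le0 // /S /= ltNge h.
  rewrite [RHS]/= -(SE true) -(SE false) /=; ring.
have [S1 mS1 S1E] := IH (w * expR t);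
  have [S2 mS2 S2E] := IH (w * expR (t - eps)).
pose S := (S1 `*` [set true] `|` S2 `*` [set false])%classic.
have mS : measurable S by apply: measurableU; exact: measurableX.
exists S => //.
have St : ysection S true = S1.
  by apply/seteqP; split => z; rewrite /ysection /= inE /S /=;
    [case=> [[]|[]//]|left].
have Sf : ysection S false = S2.
  by apply/seteqP; split => z; rewrite /ysection /= inE /S /=;
    [case=> [[]//|[]]|right].
have lawE z : fine (law (composition (fun=> rr_mechanism t x0) n.+1) z S) =
   rr_param t x0 z * fine (law (composition (fun=> rr_mechanism t x0) n) z S1) +
   (1 - rr_param t x0 z) * fine
     (law (composition (fun=> rr_mechanism t x0) n) z S2).
  transitivity (fine (\int[law (rr_mechanism t x0) z]_y
      (fine (law (composition (fun=> rr_mechanism t x0) n) z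
        (ysection S y)))%:E)%E).
    by congr fine; exact: product_probability_ysection.
  rewrite /= integral_bernoulli_prob ?rr_param_itv //.
    by rewrite St Sf.
  by move=> y; rewrite lee_fin fine_ge0.
rewrite !lawE r0 r1 pe -[RHS]/(_ * rr_div eps c (nseq n.+1 t) _ +
  _ * rr_div eps c (nseq n.+1 t) _).
by rewrite -S1E -S2E; ring.
Qed.

End RandomizedResponseMechanism.

(** * The value of the optimal delta *)

Section DeltaOpt.
Variables (R : realType) (X : Type) (nb : X -> X -> Prop) (eps : R).
Hypothesis eps_gt0 : 0 < eps.

Lemma composition_dp k epsg (N : mechanism R X) : (0 < k)%N ->
  BR_compositions nb eps k N -> dp nb epsg (delta_formula eps epsg k) N.
Proof.
case: k => // n _ [M brM ->] x x' xx' S mS /=.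
have [ts [sz tsI /(_ S 1 mS)]] := composition_rr_div_le eps_gt0 (expR epsg) xx'
  brM.
rewrite mul1r; set P := law _ _; set Q := law _ _ => PQ.
have PF : (P S = (fine (P S))%:E)%E by rewrite fineK //; exact: fin_num_measure.
have QF : (Q S = (fine (Q S))%:E)%E by rewrite fineK //; exact: fin_num_measure.
rewrite PF QF -EFinM -EFinD lee_fin -lerBlDl; apply: le_trans PQ _.
(* All offsets are replaced by their average, which lies in [0, eps] again. *)
pose m := (\sum_(t <- ts) t) / n.+1%:R.
have mE : \sum_(t <- ts) t = n.+1%:R * m by rewrite /m mulrC divfK ?pnatr_eq0.
have /allP tsI' := tsI.
have mI : 0 <= m <= eps.
  rewrite /m divr_ge0 //=; last first.
    by rewrite big_seq; apply: sumr_ge0 => t /tsI' /andP[].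
  rewrite ler_pdivrMr ?ltr0n // mulrC -sz -sum1_size natr_sum mulr_suml.
  by rewrite big_seq [leRHS]big_seq ler_sum // =>
    t /tsI' /andP[]; rewrite mul1r.
apply: le_trans (rr_div_average (expR epsg) 1 eps_gt0 sz tsI mE) _.
exact: rr_div_le_delta_formula.
Qed.

Lemma delta_opt_class_BR k epsg :
  (exists x x', x <> x' /\ nb x x') -> (0 < k)%N ->
  delta_opt_class nb (BR_compositions nb eps k) epsg =
    (delta_formula eps epsg k)%:E.
Proof.
move=> [x0 [x1 [x01 nb01]]] k_gt0; apply/eqP; rewrite eq_le; apply/andP; split.
  apply: ge_ereal_sup => _ [N brN ->]; apply: ereal_inf_lbound.
  by exists (delta_formula eps epsg k) => //; exact: composition_dp.
(* Lower bound: k copies of randomized response at the offset of a largest term; every admissible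
   delta is tested on the optimal event. *)
have [l fl] := delta_formula_attained eps epsg k.
pose t := t_star eps epsg k l.
have tI : 0 <= t <= eps by exact: t_star_itv.
apply: le_ereal_sup_tmp; exists
  (delta_opt nb (composition (fun=> rr_mechanism eps t x0) k.-1) epsg).
  exists (composition (fun=> rr_mechanism eps t x0) k.-1) => //.
  by exists (fun=> rr_mechanism eps t x0) =>
    // i _; exact: rr_mechanism_bounded_range.
apply: le_ereal_inf_tmp => _ [delta dpd <-].
have [S mS] := rr_mechanism_attains eps_gt0 (expR epsg) k.-1 1 tI (nesym x01).
rewrite prednK // -delta_termE -fl mul1r => <-.
have := dpd _ _ nb01 S mS.
set P := law _ _; set Q := law _ _.
have PF : (P S = (fine (P S))%:E)%E by rewrite fineK //; exact: fin_num_measure.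
have QF : (Q S = (fine (Q S))%:E)%E by rewrite fineK //; exact: fin_num_measure.
by rewrite PF QF -EFinM -EFinD lee_fin /= lee_fin lerBlDl.
Qed.
End DeltaOpt.

(** * The quadratic-time program *)

Section Programs.
Variable R : realType.
Implicit Types (P Q : program) (s : state R) (post mid : state R -> Prop).

(** A total-correctness Hoare triple with a cost bound. *)
Definition runs P s (c : nat) post : Prop :=
  exists n s', [/\ run P s n s', (n <= c)%N & post s'].

Fixpoint block (Ps : seq program) : program :=
  if Ps is P :: Ps' then Seq P (block Ps') else Skip.

#[local] Arguments block : simpl never.

Lemma updE s i v j : upd s i v j = if j == i then v else s j.
Proof. by []. Qed.

Lemma runs_seq P Q s c1 c2 mid post : runs P s c1 mid ->
  (forall s', mid s' -> runs Q s' c2 post) -> runs (Seq P Q) s (c1 + c2) post.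
Proof.
move=> [m [s1 [r1 mc mid1]]] /(_ _ mid1) [n [s2 [r2 nc post2]]].
exists (m + n)%N, s2; rewrite leq_add //; split => //.
by econstructor; eassumption.
Qed.

Lemma runs_nil s post : post s -> runs (block [::]) s 0 post.
Proof. by move=> ps; exists 0%N, s; split => //; constructor. Qed.

Lemma runs_const_upd s i n : runs (Const i n) s 1 (eq (upd s i n%:R)).
Proof. by exists 1%N, (upd s i n%:R); split => //; constructor. Qed.

Lemma runs_arith_upd op s i j l v : (op = Div -> s l != 0) ->
  arith_fun op (s j) (s l) = v -> runs (Arith op i j l) s 1 (eq (upd s i v)).
Proof.
move=> d <-; exists 1%N, (upd s i (arith_fun op (s j) (s l))).
by split => //; constructor.
Qed.

Lemma runs_const i n Ps s c post :
  runs (block Ps) (upd s i n%:R) c post ->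
    runs (block (Const i n :: Ps)) s c.+1 post.
Proof.
by move=> h; apply: runs_seq (runs_const_upd s i n) _ => _ <-.
Qed.

Lemma runs_arith op i j l Ps s c post : (op = Div -> s l != 0) ->
  runs (block Ps) (upd s i (arith_fun op (s j) (s l))) c post ->
  runs (block (Arith op i j l :: Ps)) s c.+1 post.
Proof.
by move=> d h; apply: runs_seq (runs_arith_upd i d erefl) _ => _ <-.
Qed.

Lemma runs_exp i j Ps s c post :
  runs (block Ps) (upd s i (expR (s j))) c post ->
    runs (block (Exp i j :: Ps)) s c.+1 post.
Proof.
move=> h; apply: (@runs_seq _ _ _ 1 _ (eq (upd s i (expR (s j))))) =>
  [|_ <- //].
by exists 1%N, (upd s i (expR (s j))); split => //; constructor.
Qed.

(** Both branches update the same register r only, so the test becomes one conditional update and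
    the symbolic execution does not fork. *)
Lemma runs_if i j P Q r v w Ps s c1 c post :
  runs P s c1 (eq (upd s r v)) -> runs Q s c1 (eq (upd s r w)) ->
  runs (block Ps) (upd s r (if s i <= s j then v else w)) c post ->
  runs (block (If i j P Q :: Ps)) s (c1.+1 + c) post.
Proof.
move=> [n1 [s1 [r1 nc1 e1]]] [n2 [s2 [r2 nc2 e2]]] h.
apply: (runs_seq (mid := eq (upd s r (if s i <= s j then v else w)))) =>
  [|_ <- //].
have [ij|ji] := leP (s i) (s j).
  by exists n1.+1, s1; split => //; exact: run_if_true.
by exists n2.+1, s2; split => //; exact: run_if_false.
Qed.

Lemma upd_id s i : upd s i (s i) = s.
Proof. by apply/funext => j; rewrite /upd; case: eqP => // ->. Qed.

Lemma runs_skip_upd s i c : runs Skip s c (eq (upd s i (s i))).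
Proof. by exists 0%N, s; rewrite upd_id; split => //; constructor. Qed.

(** Each of the N rounds costs c and one test; the extra 1 is the final, failing test. *)
Lemma runs_while (I : nat -> state R -> Prop) i j P c N s :
  (forall m s, (m < N)%N -> I m s -> s i <= s j /\ runs P s c (I m.+1)) ->
  (forall s, I N s -> s j < s i) ->
  I 0%N s -> runs (While i j P) s (N * c.+1).+1 (I N).
Proof.
move=> step stop I0.
suff H k m s' : (m + k = N)%N -> I m s' ->
  runs (While i j P) s' (k * c.+1).+1 (I N).
  exact: H (add0n N) I0.
elim: k m s' {I0} => [|k IH] m s'.
  rewrite addn0 => -> IN; exists 1%N, s'; split => //.
  by apply: run_while_false; exact: stop.
move=> mN Im.
have mltN : (m < N)%N by rewrite -mN -addSnnS leq_addr.
have [ij [n [s1 [r1 nc I1]]]] := step _ _ mltN Im.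
have [n' [s2 [r2 nc' I2]]] := IH m.+1 s1 (etrans (addSnnS _ _) mN) I1.
exists (n + n').+1, s2; split => //; first exact: run_while_true r1 r2.
by rewrite mulSn ltnS addSnnS leq_add.
Qed.

End Programs.

(* Registers: 0 = eps, 1 = epsg, 2 = k, 3 = 0, 4 = 1, 5 = k + 1, 6 = e^epsg,
   7 = e^-eps, 8 = 1 - e^-eps, 9 = l, 10 = running maximum, 11 = t, 12 = p,
   13 = 1 - p, 14 = i, 15 = C(k, i) (1 - p)^i, 16 = Horner partial sum in p
   (which, unlike a recurrence on whole terms, never divides by p or 1 - p);
   17 and 18 are scratch. *)
Definition term_body : program := block [::
  Arith Mul 17 14 0; Arith Mul 18 2 11; Arith Defs.Sub 17 18 17; Exp 17 17;
  Arith Defs.Sub 17 17 6; If 3 17 Skip (Const 17 0); Arith Mul 17 15 17;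
  Arith Mul 16 16 12; Arith Add 16 16 17;
  Arith Defs.Sub 17 2 14; Arith Mul 15 15 13; Arith Mul 15 15 17;
  Arith Add 14 14 4; Arith Div 15 15 14].

(** Adding register 3, which holds 0, serves as a copy instruction. *)
Definition offset_setup : program := block [::
  Arith Add 17 9 4; Arith Mul 17 17 0; Arith Add 17 1 17; Arith Div 11 17 5;
  If 3 11 Skip (Const 11 0); If 11 0 Skip (Arith Add 11 0 3);
  Arith Defs.Sub 12 3 11; Exp 12 12; Arith Defs.Sub 12 12 7; Arith Div 12 12 8;
  Arith Defs.Sub 13 4 12; Const 14 0; Const 15 1; Const 16 0].

Definition max_update : program := block [::
  If 10 16 (Arith Add 10 16 3) Skip; Arith Add 9 9 4].

(** Registers 3, 9 and 10 get their initial value 0 from [input], which is 0 beyond register 2. *)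
Definition delta_setup : program := block [::
  Const 4 1; Arith Add 5 2 4; Exp 6 1; Arith Defs.Sub 7 3 0; Exp 7 7;
    Arith Defs.Sub 8 4 7].

Definition delta_program : program :=
  Seq delta_setup
    (Seq (While 9 2 (Seq offset_setup (Seq (While 14 2 term_body) max_update)))
         (block [:: Arith Add 0 10 3])).

(** * Correctness and running time of the program *)

Section DeltaProgram.
Variables (R : realType) (eps epsg : R) (k : nat).
#[local] Arguments block : simpl never.
#[local] Arguments upd : simpl never.
Hypotheses (eps_gt0 : 0 < eps) (k_gt0 : (0 < k)%N).

Definition constants (s : state R) : Prop :=
  [/\ [/\ s 0%N = eps, s 1%N = epsg, s 2%N = k%:R & s 3%N = 0],
      [/\ s 4%N = 1, s 5%N = k.+1%:R & s 6%N = expR epsg] &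
      s 7%N = expR (- eps) /\ s 8%N = 1 - expR (- eps)].

Definition max_inv (l : nat) (s : state R) : Prop :=
  [/\ constants s, s 9%N = l%:R &
      s 10%N = \big[Num.max/0]_(j < l) delta_term eps epsg k j].

(** The exponent [i.-1 - j] is that of Horner's rule: each round multiplies the partial sum by p,
    and at i = k + 1 it has become k - j. *)
Definition term_inv (l : nat) (t : R) (i : nat) (s : state R) : Prop :=
  [/\ max_inv l s, [/\ s 11%N = t, s 12%N = p_ eps t & s 13%N = 1 - p_ eps t],
      s 14%N = i%:R,
      s 15%N = 'C(k, i)%:R * (1 - p_ eps t) ^+ i &
      s 16%N = \sum_(j < i) 'C(k, j)%:R * p_ eps t ^+ (i.-1 - j) *
        (1 - p_ eps t) ^+ j *
        Num.max (expR (k%:R * t - j%:R * eps) - expR epsg) 0].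

Lemma term_body_inv l t i s : (i < k.+1)%N -> term_inv l t i s ->
  s 14%N <= s 2%N /\ runs term_body s 15 (term_inv l t i.+1).
Proof.
move=> ik [[cs s9 s10] [s11 s12 s13] s14 s15 s16].
have [[s0 s1 s2 s3] [s4 s5 s6] [s7 s8]] := cs.
split; first by rewrite s14 s2 ler_nat -ltnS.
rewrite /term_body.
have sE := (s0, s2, s3, s4, s6, s11, s12, s13, s14, s15).
do 3 (apply: runs_arith => //; rewrite ?updE /= ?sE).
apply: runs_exp; rewrite ?updE /= ?sE.
apply: runs_arith => //; rewrite ?updE /= ?sE.
apply: (@runs_if _ _ _ _ _ 17 _ 0%:R _ _ 1 8); first exact: runs_skip_upd.
  exact: runs_const_upd.
rewrite ?updE /= ?sE.
do 7 (apply: runs_arith => //; rewrite ?updE /= ?sE).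
apply: runs_arith => [_|]; rewrite ?updE /= ?sE;
  first by rewrite natr1 pnatr_eq0.
apply: runs_nil.
split; [|split| | |]; rewrite ?updE //=.
- by rewrite natr1.
- rewrite natr1 -natrB // exprSr; apply: (mulIf (_ : i.+1%:R != 0 :> R));
    first by rewrite pnatr_eq0.
  rewrite divfK ?pnatr_eq0 //.
  (* The recurrence for consecutive binomial coefficients; at i = k it sets register 15 to 0. *)
  have binE : (k - i)%:R * 'C(k, i)%:R = i.+1%:R * 'C(k, i.+1)%:R :> R.
    by rewrite -!natrM mul_bin_left.
  transitivity ((k - i)%:R * 'C(k, i)%:R *
    ((1 - p_ eps t) ^+ i * (1 - p_ eps t))).
    by ring.
  by rewrite binE; ring.
- rewrite s16 big_ord_recr /= subnn expr0 mulr1 mulr_suml; congr (_ + _ * _).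
    apply: eq_bigr => j _.
    by rewrite -(subnSK (ltn_ord j)) subnS predn_sub exprSr; ring.
  by case: leP => h; rewrite ?max_l ?max_r // ltW.
Qed.

Lemma offset_setup_inv l s : max_inv l s ->
  runs offset_setup s 16 (term_inv l (t_star eps epsg k l) 0).
Proof.
move=> [cs s9 s10].
have [[s0 s1 s2 s3] [s4 s5 s6] [s7 s8]] := cs.
rewrite /offset_setup.
have sE := (s0, s1, s2, s3, s4, s5, s6, s7, s8, s9).
do 3 (apply: runs_arith => //; rewrite ?updE /= ?sE).
apply: runs_arith => [_|]; rewrite ?updE /= ?sE; first by rewrite pnatr_eq0.
apply: (@runs_if _ _ _ _ _ 11 _ 0%:R _ _ 1 10); first exact: runs_skip_upd.
  exact: runs_const_upd.
rewrite ?updE /= ?sE.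
apply: (@runs_if _ _ _ _ _ 11 _ (eps + 0) _ _ 1 8); first exact: runs_skip_upd.
  by apply: runs_arith_upd => //; rewrite !updE /= !sE.
rewrite ?updE /= ?sE.
(* The program clamps at 0 first and at eps second; this agrees with [t_star] because [0 < eps]. *)
have -> : (if (if 0 <= (epsg + (l%:R + 1) * eps) / k.+1%:R
    then (epsg + (l%:R + 1) * eps) / k.+1%:R else 0) <= eps
  then if 0 <= (epsg + (l%:R + 1) * eps) / k.+1%:R
    then (epsg + (l%:R + 1) * eps) / k.+1%:R else 0
  else eps + 0) = t_star eps epsg k l.
  rewrite /t_star natr1 addr0; set u := _ / _.
  by case: (ltP u 0) => h1; [rewrite (ltW eps_gt0) | case: (ltP eps u)].
have a1 := expRN_lt1 eps_gt0.
apply: runs_arith => //; rewrite ?updE /= ?sE.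
apply: runs_exp; rewrite ?updE /= ?sE.
apply: runs_arith => //; rewrite ?updE /= ?sE.
apply: runs_arith => [_|]; rewrite ?updE /= ?sE;
  first by rewrite gt_eqF // subr_gt0.
apply: runs_arith => //; rewrite ?updE /= ?sE.
do 3 (apply: runs_const; rewrite ?updE /= ?sE).
apply: runs_nil.
split; [split| split| | |]; rewrite ?updE //= ?sub0r //.
  by rewrite bin0 expr0 mulr1.
by rewrite big_ord0.
Qed.

Lemma bigmax_ord_recr (x : R) n (F : nat -> R) :
  \big[Num.max/x]_(i < n.+1) F i = Num.max (\big[Num.max/x]_(i < n) F i) (F n).
Proof.
apply/eqP; rewrite eq_le; apply/andP; split.
  apply: bigmax_le => [|i _]; first by rewrite le_max bigmax_ge_id.
  rewrite le_max; have := ltn_ord i; rewrite ltnS leq_eqVlt =>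
    /predU1P[->|iltn].
    by rewrite lexx orbT.
  by rewrite (le_bigmax _ (fun j : 'I_n => F j) (Ordinal iltn)).
rewrite ge_max (le_bigmax _ (fun j : 'I_n.+1 => F j) ord_max) andbT.
apply: bigmax_le => [|i _]; first exact: bigmax_ge_id.
exact: (le_bigmax _ (fun j : 'I_n.+1 => F j) (widen_ord (leqnSn n) i)).
Qed.

Lemma max_update_inv l s : term_inv l (t_star eps epsg k l) k.+1 s ->
  runs max_update s 3 (max_inv l.+1).
Proof.
move=> [[cs s9 s10] _ _ _ s16].
have [[s0 s1 s2 s3] [s4 s5 s6] [s7 s8]] := cs.
rewrite /max_update.
apply: (@runs_if _ _ _ _ _ 10 (s 16%N + 0) (s 10%N) _ _ 1 1); last 2 first.
- exact: runs_skip_upd.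
- apply: runs_arith => //; rewrite ?updE /= ?s9 ?s4.
  apply: runs_nil; split; [exact: cs | by rewrite updE /= natr1 | rewrite !updE
    /=].
  rewrite bigmax_ord_recr -s10 addr0.
  rewrite (_ : delta_term eps epsg k l = s 16%N); last by rewrite s16.
  by case: leP.
by apply: runs_arith_upd; rewrite ?s3.
Qed.

Lemma delta_setup_inv : runs delta_setup (input eps epsg k) 6 (max_inv 0).
Proof.
rewrite /delta_setup.
apply: runs_const; rewrite ?updE /=.
apply: runs_arith => //; rewrite ?updE /=.
apply: runs_exp; rewrite ?updE /=.
apply: runs_arith => //; rewrite ?updE /=.
apply: runs_exp; rewrite ?updE /=.
apply: runs_arith => //; rewrite ?updE /=.
apply: runs_nil; split; [split; split| |]; rewrite ?updE //= ?natr1 ?sub0r //.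
by rewrite big_ord0.
Qed.

(** All terms are nonnegative, so the program may start its maximum at 0 instead of at the term l =
    0. *)
Lemma bigmax_delta_formula :
  \big[Num.max/0]_(l < k.+1) delta_term eps epsg k l = delta_formula eps epsg k.
Proof.
have t0 := delta_term_ge0 epsg k 0 eps_gt0.
apply/eqP; rewrite eq_le; apply/andP; split; apply: bigmax_le.
- exact: le_trans t0 (bigmax_ge_id _ _ _ _).
- by move=> l _; exact: le_bigmax.
- exact: (le_bigmax _ (fun l : 'I_k.+1 => delta_term eps epsg k l) ord0).
- by move=> l _; exact: le_bigmax.
Qed.

Lemma delta_program_runs : runs delta_program (input eps epsg k) (200 * k ^ 2)
  (fun s => s 0%N = delta_formula eps epsg k).
Proof.
have outer s m : (m < k.+1)%N -> max_inv m s -> s 9%N <= s 2%N /\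
    runs (Seq offset_setup (Seq (While 14 2 term_body) max_update)) s
      (16 + ((k.+1 * 16).+1 + 3)) (max_inv m.+1).
  move=> mk inv; split.
    by case: inv => [[[_ _ -> _] _ _] -> _]; rewrite ler_nat -ltnS.
  apply: runs_seq (offset_setup_inv inv) _ => s1 inv1.
  apply: runs_seq (fun s2 => @max_update_inv m s2).
  apply: (runs_while (I := term_inv m (t_star eps epsg k m))) inv1.
    by move=> i s2; exact: term_body_inv.
  by move=> s2 [[[[_ _ -> _] _ _] _ _] _ -> _ _]; rewrite ltr_nat.
have [n [s [rn nc s0]]] : runs delta_program (input eps epsg k)
    (6 + ((k.+1 * (16 + ((k.+1 * 16).+1 + 3)).+1).+1 + 1))
    (fun s => s 0%N = delta_formula eps epsg k).
  apply: runs_seq delta_setup_inv _ => s0 inv0.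
  apply: (runs_seq (mid := max_inv k.+1)).
    apply: runs_while inv0; first by move=> m s1; exact: outer.
    by move=> s1 [[[_ _ -> _] _ _] -> _]; rewrite ltr_nat.
  move=> s1 [[[_ _ _ s3] _ _] _ s10].
  apply: runs_arith => //; apply: runs_nil.
  by rewrite updE /= s3 addr0 s10 bigmax_delta_formula.
exists n, s; split => //; apply: leq_trans nc _.
(* With N = k + 1 the bound is 16 N^2 + 21 N + 8, and N <= 2 k makes it at most 114 k^2. *)
by move: k_gt0; rewrite -mulnn; nia.
Qed.
End DeltaProgram.

Theorem theorem3 (R : realType) :
  (forall (X : Type) (nb : X -> X -> Prop)
          (nb_sym : forall x x', nb x x' -> nb x' x)
          (nb_pair : exists x x', x <> x' /\ nb x x')
          (eps : R) (k : nat) (epsg : R),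
      0 < eps -> (0 < k)%N ->
      delta_opt_class nb (BR_compositions nb eps k) epsg
      = (delta_formula eps epsg k)%:E)
  /\
  (exists (P : program) (C : nat),
      forall (eps : R) (k : nat) (epsg : R), 0 < eps -> (0 < k)%N ->
      exists (n : nat) (s : state R),
        [/\ run P (input eps epsg k) n s,
            s 0%N = delta_formula eps epsg k &
            (n <= C * k ^ 2)%N]).
Proof.
split=> [X nb _ nb_pair eps k epsg eps_gt0 k_gt0|].
  exact: delta_opt_class_BR.
exists delta_program, 200%N => eps k epsg eps_gt0 k_gt0.
have [n [s [nP nc s0]]] := delta_program_runs epsg eps_gt0 k_gt0.
by exists n, s.
Qed.
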